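(* Let $p,q$ be integers with $1\le p<q-p$, and let $u=0^{q-p}1^p$. Then for every binary word $w\in\{0,1\}^q$ with exactly $p$ ones, $$\mathcal{P}_i(u)\le\mathcal{P}_i(w)\quad\text{for all }1\le i\le q.$$ In other words, the orbit of $u$ is the greatest element of the set $\mathbb{W}_{p,q}$ of orbits with respect to the order $\prec_p$.
   Context: Binary alphabet $\{0,1\}$ with $0<1$; words of equal length are compared lexicographically. For a word $x=x_1\cdots x_n$, $(x)_2=\sum_{i=1}^n x_i2^{n-i}$. The cyclic shift is $\sigma(w_1\cdots w_n)=w_2\cdots w_nw_1$. For $w\in\{0,1\}^q$, $\mathcal{O}_1(w)\le\dots\le\mathcal{O}_q(w)$ are the $q$ words $w,\sigma(w),\dots,\sigma^{q-1}(w)$ sorted lexicographically (with repetition), and $\mathcal{I}_k(w)=(\mathcal{O}_k(w))_2$. Partial products: $\mathcal{P}_i(w)=\prod_{k=1}^i\mathcal{I}_k(w)$. $\mathbb{W}_{p,q}$ is the set of orbits (words up to cyclic shift) of binary words of length $q$ with $p$ ones; for orbits $w,w'$, $w'\prec_p w$ means $\mathcal{P}_i(w')\ge\mathcal{P}_i(w)$ for all $1\le i\le q$. *)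

(* Defs.v *)
From mathcomp Require Import all_boot.
Set Implicit Arguments. Unset Strict Implicit. Unset Printing Implicit Defensive.

Fixpoint lexle (x y : seq bool) : bool :=
  match x, y with
  | [::], _ => true
  | _ :: _, [::] => false
  | a :: x', b :: y' => (a < b) || ((a == b) && lexle x' y')
  end.

Definition bin_val (x : seq bool) : nat :=
  foldl (fun acc (b : bool) => acc.*2 + b) 0 x.

Definition shifts (w : seq bool) : seq (seq bool) :=
  [seq rot k w | k <- iota 0 (size w)].

Definition sorted_shifts (w : seq bool) : seq (seq bool) :=
  sort lexle (shifts w).

Definition Ival (w : seq bool) (k : nat) : nat :=
  bin_val (nth [::] (sorted_shifts w) k.-1).

Definition Pprod (w : seq bool) (i : nat) : nat :=
  \prod_(1 <= k < i.+1) Ival w k.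

Definition uword (p q : nat) : seq bool := nseq (q - p) false ++ nseq p true.

(* Main.v *)
(* Write n = q - p.  The partial sums already satisfy S_i(u) <= S_i(w); since the
   I_k(w) are nondecreasing, Abel summation gives sum_(k <= i) I_k(u)/I_k(w) <= i,
   and AM-GM turns this into P_i(u) <= P_i(w).

   For i <= n the i smallest rotations of w start with 0, and any i rotations of w
   starting with 0 have values summing to at least (2^i - 1)(2^p - 1) = S_i(u).
   This is an induction on w, peeling off its first letter.  For i > n one bounds
   the q - i largest rotations from above by applying the same estimate to the
   complement of w, and uses that all rotations together sum to p(2^q - 1). *)
Require Import Defs.
From mathcomp Require Import all_boot.
From mathcomp Require Import all_order all_algebra zify.
Set Implicit Arguments. Unset Strict Implicit. Unset Printing Implicit Defensive.

(** * Binary values of words *)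

Lemma bin_val_cat x y : bin_val (x ++ y) = bin_val x * 2 ^ size y + bin_val y.
Proof.
rewrite /bin_val foldl_cat; set a := foldl _ 0 x; move: a.
elim: y => [|b y IH] a /=; first by rewrite expn0 muln1 addn0.
by rewrite IH (IH (0.*2 + b)) expnS; lia.
Qed.

Lemma bin_val_cons b x : bin_val (b :: x) = b * 2 ^ size x + bin_val x.
Proof. by rewrite -cat1s bin_val_cat /bin_val; case: b. Qed.

Lemma bin_val_lt x : bin_val x < 2 ^ size x.
Proof. by elim: x => [|b x IH] //; rewrite bin_val_cons /= expnS; case: b => /=; lia. Qed.

(** With c ones, the smallest value is reached when all ones stand at the end, and it is 2^c - 1. *)
Lemma bin_val_ones x : 2 ^ count id x <= (bin_val x).+1.
Proof.
elim: x => [|b x IH] //; rewrite bin_val_cons /= expnD.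
have : 2 ^ count id x <= 2 ^ size x by rewrite leq_exp2l // count_size.
by case: b => /=; lia.
Qed.

Lemma bin_val_negb x : bin_val (map negb x) + bin_val x + 1 = 2 ^ size x.
Proof.
by elim: x => [|b x IH] //=; rewrite !bin_val_cons size_map expnS; case: b => /=; lia.
Qed.

Lemma lexle_bin_val x y : size x = size y -> lexle x y = (bin_val x <= bin_val y).
Proof.
elim: x y => [|a x IH] [|b y] //= [sxy]; rewrite IH // !bin_val_cons sxy.
have := bin_val_lt x; have := bin_val_lt y; rewrite sxy.
by case: a; case: b => /=; lia.
Qed.

(** * Sums over marked rotations, by induction on the word *)

Section Marked.
Implicit Types (w : seq bool) (T : nat -> bool).

(* When a letter is put in front of [w], the part of a rotation that precedes the
   cut is shifted by one place: [marked_drop_sum] is the resulting increment of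
   [marked_rot_sum]. *)
Definition marked_rot_sum w T :=
  \sum_(0 <= k < size w) T k * bin_val (rot k w).
Definition marked_drop_sum w T :=
  \sum_(0 <= k < size w) T k * (bin_val (drop k w) * 2 ^ k).
Definition marked_pow_sum w T := \sum_(0 <= k < size w) T k * 2 ^ k.
Definition nmarks w T := \sum_(0 <= k < size w) (T k : nat).

Lemma bin_val_rot k w : k <= size w ->
  bin_val (rot k w) = bin_val (drop k w) * 2 ^ k + bin_val (take k w).
Proof. by move=> kw; rewrite /rot bin_val_cat size_takel. Qed.

Lemma marked_drop_sum_cons b w T : marked_drop_sum (b :: w) T =
  T 0 * bin_val (b :: w) + 2 * marked_drop_sum w (T \o succn).
Proof.
rewrite /marked_drop_sum /= big_nat_recl //= expn0 muln1; congr (_ + _).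
by rewrite big_distrr; apply: eq_bigr => k _; rewrite expnS /=; lia.
Qed.

Lemma marked_pow_sum_cons b w T : marked_pow_sum (b :: w) T =
  T 0 + 2 * marked_pow_sum w (T \o succn).
Proof.
rewrite /marked_pow_sum /= big_nat_recl //= expn0 muln1; congr (_ + _).
by rewrite big_distrr; apply: eq_bigr => k _; rewrite expnS /=; lia.
Qed.

Lemma nmarks_cons b w T : nmarks (b :: w) T = T 0 + nmarks w (T \o succn).
Proof. by rewrite /nmarks /= big_nat_recl. Qed.

Lemma marked_rot_sum_cons b w T : marked_rot_sum (b :: w) T =
  T 0 * bin_val (b :: w) + marked_rot_sum w (T \o succn)
  + marked_drop_sum w (T \o succn) + b * marked_pow_sum w (T \o succn).
Proof.
rewrite /marked_rot_sum /= big_nat_recl //= rot0 -!addnA; congr (_ + _).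
rewrite /marked_drop_sum /marked_pow_sum big_distrr -!big_split /=.
rewrite big_nat [RHS]big_nat; apply: eq_bigr => k /= kw.
rewrite !bin_val_rot ?bin_val_cons ?size_takel //=; [|lia..].
rewrite -/(take k w) expnS.
by case: (T k.+1); case: b => /=; lia.
Qed.

Definition marks_zeros w T := forall k, k < size w -> T k -> ~~ nth false w k.

Lemma marks_zeros_cons b w T :
  marks_zeros (b :: w) T -> ~~ (T 0 && b) /\ marks_zeros w (T \o succn).
Proof.
by move=> H; split=> [|k kw]; [apply/negP => /andP[/(H 0 isT)/negP]|apply: (H k.+1)].
Qed.

Lemma nmarks_ones_le_size w T :
  marks_zeros w T -> nmarks w T + count id w <= size w.
Proof.
elim: w T => [|b w IH] T /=; first by rewrite /nmarks big_nil.
move=> /marks_zeros_cons[T0 /IH]; rewrite nmarks_cons.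
by case: (T 0) T0; case: b => //= _; lia.
Qed.

(** Used when a marked 0 is put in front of [w]: the new mark contributes [bin_val w], and the old
    marks gain [marked_drop_sum]. *)
Lemma marked_drop_sum_ge_val w T : marks_zeros w T ->
  2 ^ (nmarks w T + count id w) <=
  marked_drop_sum w T + bin_val w + 2 ^ nmarks w T.
Proof.
elim: w T => [|b w IH] T /=; first by rewrite /nmarks big_nil leq_addl.
move=> /marks_zeros_cons[T0 Hw].
have := IH _ Hw; have := nmarks_ones_le_size Hw.
rewrite nmarks_cons marked_drop_sum_cons bin_val_cons.
(* Marks and ones occupy distinct positions, so 2^(m+p) <= 2^(size w); this pays for a front letter
   1. *)
rewrite -(leq_exp2l (m := 2)) // !expnD.
by case: (T 0) T0; case: b => //= _; nia.
Qed.

(** Used when a 1 is put in front of [w]: it carries no mark, but in the rotation by k + 1 it lands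
    at weight 2^k. *)
Lemma marked_drop_sum_ge_pow w T : marks_zeros w T ->
  2 ^ (nmarks w T + count id w) <=
  marked_drop_sum w T + marked_pow_sum w T + 2 ^ count id w.
Proof.
elim: w T => [|b w IH] T /=; first by rewrite /nmarks big_nil leq_addl.
move=> /marks_zeros_cons[T0 Hw].
have := IH _ Hw; have := bin_val_ones w.
rewrite nmarks_cons marked_drop_sum_cons marked_pow_sum_cons bin_val_cons !expnD.
by case: (T 0) T0; case: b => //= _; nia.
Qed.

(* (2^m - 1)(2^p - 1) <= sum, for m marks and p ones, free of subtractions. *)
Lemma marked_rot_sum_ge w T : marks_zeros w T ->
  2 ^ (nmarks w T + count id w) + 1 <=
  marked_rot_sum w T + 2 ^ nmarks w T + 2 ^ count id w.
Proof.
elim: w T => [|b w IH] T /=; first by rewrite /nmarks big_nil -addnA leq_addl.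
move=> /marks_zeros_cons[T0 Hw].
have := IH _ Hw; have := marked_drop_sum_ge_val Hw; have := marked_drop_sum_ge_pow Hw.
rewrite nmarks_cons marked_rot_sum_cons bin_val_cons !expnD.
by case: (T 0) T0; case: b => //= _; nia.
Qed.

(** A one of weight 2^e survives in [drop k w] for each k up to its own position; the geometric sum
    over k gives 2^(size w) - 2^e. *)
Lemma drop_sum_total w :
  marked_drop_sum w xpredT + bin_val w = count id w * 2 ^ size w.
Proof.
elim: w => [|b w IH]; first by rewrite /marked_drop_sum big_nil.
rewrite marked_drop_sum_cons /= bin_val_cons expnS.
rewrite -[marked_drop_sum w _]/(marked_drop_sum w xpredT).
by case: b => /=; nia.
Qed.

Lemma pow_sum_total w : marked_pow_sum w xpredT + 1 = 2 ^ size w.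
Proof.
elim: w => [|b w IH]; first by rewrite /marked_pow_sum big_nil.
rewrite marked_pow_sum_cons /= expnS.
rewrite -[marked_pow_sum w _]/(marked_pow_sum w xpredT).
by lia.
Qed.

(** Across all rotations each one visits every position once, contributing 2^(size w) - 1. *)
Lemma rot_sum_total w :
  marked_rot_sum w xpredT + count id w = count id w * 2 ^ size w.
Proof.
elim: w => [|b w IH]; first by rewrite /marked_rot_sum big_nil.
rewrite marked_rot_sum_cons /= bin_val_cons expnS.
have := drop_sum_total w; have := pow_sum_total w.
rewrite -[marked_pow_sum w (_ \o _)]/(marked_pow_sum w xpredT).
rewrite -[marked_drop_sum w (_ \o _)]/(marked_drop_sum w xpredT).
rewrite -[marked_rot_sum w (_ \o _)]/(marked_rot_sum w xpredT).
by case: b => /=; nia.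
Qed.

End Marked.

(** * Ranking the rotations of a word by value *)

Lemma sum_mem_subseq (s : seq nat) n (f : nat -> nat) :
  uniq s -> {in s, forall k, k < n} ->
  \sum_(0 <= k < n) (k \in s) * f k = \sum_(k <- s) f k.
Proof.
move=> us sn; rewrite (eq_bigr (fun k => if k \in s then f k else 0)).
  rewrite -big_mkcond -big_filter; apply: perm_big; apply: uniq_perm => //.
    by rewrite filter_uniq // iota_uniq.
  move=> k; rewrite mem_filter mem_index_iota /=.
  by case: (boolP (k \in s)) => // /sn ->.
by move=> k _; case: ifP; rewrite ?mul1n ?mul0n.
Qed.

Lemma sorted_bool_nseq (s : seq bool) : sorted implb s ->
  s = nseq (size s - count id s) false ++ nseq (count id s) true.
Proof.
elim: s => [|b s IH] //= bs; have ss := path_sorted bs.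
have cs := count_size id s; have := IH ss.
case: b bs => [bs|_]; last by rewrite add0n subSn //= => <-.
have -> : s = nseq (size s) true.
  apply/all_pred1P; move: bs; rewrite (path_sortedE (leT := implb)) => [/andP[]|].
    by move=> /allP h _; apply/allP => x /h /= ->.
  by case=> [] [] [].
by rewrite count_nseq size_nseq mul1n subnn add1n subnn.
Qed.

Lemma lexle_total : total lexle.
Proof. by elim=> [|[] x IH] [|[] y] //=; rewrite IH. Qed.

Section Ranking.
Variable w : seq bool.
Let q := size w.
Let p := count id w.
Let n := q - p.

Definition rot_val k := bin_val (rot k w).

(** Sorting positions instead of words keeps equal rotations apart and lets a prefix or suffix of
    the list serve as a set of marks. *)
Definition rank_seq := sort (relpre rot_val leq) (iota 0 q).

Lemma size_rank_seq : size rank_seq = q.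
Proof. by rewrite size_sort size_iota. Qed.

Lemma perm_rank_seq : perm_eq rank_seq (iota 0 q).
Proof. by rewrite perm_sort. Qed.

Lemma uniq_rank_seq : uniq rank_seq.
Proof. by rewrite sort_uniq iota_uniq. Qed.

Lemma mem_rank_seq k : (k \in rank_seq) = (k < q).
Proof. by rewrite mem_sort mem_iota. Qed.

(** All rotations have the same length, where lexicographic and numeric order agree. *)
Lemma map_bin_val_sorted_shifts :
  [seq bin_val x | x <- sorted_shifts w] = sort leq [seq rot_val k | k <- iota 0 q].
Proof.
apply: (sorted_eq leq_trans anti_leq); last 1 first.
- by rewrite perm_sym perm_sort (map_comp bin_val (rot^~ w)) perm_map // perm_sym perm_sort.
- rewrite sorted_map; apply: (@sub_in_sorted _ [pred x | size x == q] lexle).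
  + by move=> x y /eqP sx /eqP sy /=; rewrite lexle_bin_val // sx.
  + by apply/allP => x; rewrite mem_sort => /mapP[k _ ->] /=; rewrite size_rot.
  + exact: sort_sorted lexle_total _.
- exact: sort_sorted leq_total _.
Qed.

Lemma IvalE k : k < q -> Ival w k.+1 = rot_val (nth 0 rank_seq k).
Proof.
move=> kq; rewrite /Ival /= -(nth_map 0 0) ?size_rank_seq // -sort_map.
rewrite -map_bin_val_sorted_shifts (nth_map [::]) //.
by rewrite size_sort size_map size_iota.
Qed.

Lemma rot_val_sorted : sorted (relpre rot_val leq) rank_seq.
Proof. by apply: sort_sorted => x y; apply: leq_total. Qed.

Lemma rot_val_head k : k < q ->
  (2 ^ q.-1 <= rot_val k) = nth false w k.
Proof.
move=> kq; rewrite /rot_val /rot (drop_nth false) // cat_cons bin_val_cons.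
set y := _ ++ _.
have sy : size y = q.-1 by rewrite size_cat size_drop size_takel; rewrite -/q; lia.
have := bin_val_lt y; rewrite sy.
by case: (nth false w k) => /=; lia.
Qed.

(** The leading letter dominates the value, so the first letters of the ranked rotations are
    nondecreasing; they also rearrange [w]. *)
Lemma map_nth_rank_seq :
  [seq nth false w k | k <- rank_seq] = nseq n false ++ nseq p true.
Proof.
have pE : perm_eq [seq nth false w k | k <- rank_seq] w.
  by rewrite -[X in perm_eq _ X](mkseq_nth false); apply: perm_map perm_rank_seq.
rewrite [LHS]sorted_bool_nseq; last first.
  rewrite sorted_map; apply: (sub_in_sorted (P := gtn q)) rot_val_sorted.
    by move=> a b aq bq /= ab; rewrite -!rot_val_head //; apply/implyP => /leq_trans; apply.
  by apply/allP => k; rewrite mem_rank_seq.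
by rewrite (perm_size pE) (permP pE).
Qed.

Lemma nth_rank_seq k : k < q -> nth false w (nth 0 rank_seq k) = (n <= k).
Proof.
move=> kq; rewrite -(nth_map 0 false (nth false w)) ?size_rank_seq //.
have pq : p <= q by apply: count_size.
rewrite map_nth_rank_seq nth_cat size_nseq.
case: ltnP => kn; rewrite nth_nseq ?kn //.
by case: ltnP => //; rewrite /n; lia.
Qed.

Lemma sum_rot_val : \sum_(k <- rank_seq) rot_val k + p = p * 2 ^ q.
Proof.
rewrite -rot_sum_total /marked_rot_sum (perm_big _ perm_rank_seq) /index_iota subn0.
by congr (_ + _); apply: eq_bigr => k _; rewrite mul1n.
Qed.

Lemma sum_take_rank_seq i : i <= n ->
  2 ^ (i + p) + 1 <= \sum_(k <- take i rank_seq) rot_val k + 2 ^ i + 2 ^ p.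
Proof.
move=> i_n; set s := take i rank_seq.
have us : uniq s by apply: take_uniq uniq_rank_seq.
have ss : size s = i by rewrite size_takel // size_rank_seq /n; lia.
have sq : {in s, forall k, k < q} by move=> k /mem_take; rewrite mem_rank_seq.
have Tz : marks_zeros w (mem s).
  move=> k kq /(nthP 0)[j]; rewrite ss => ji <-.
  by rewrite nth_take // nth_rank_seq -?ltnNge; rewrite /n in i_n *; lia.
have := marked_rot_sum_ge Tz; rewrite /nmarks /marked_rot_sum.
rewrite sum_mem_subseq // -/q.
rewrite (eq_bigr (fun k => (k \in s) * 1)) => [|k _]; last by rewrite muln1.
by rewrite sum_mem_subseq // sum1_size ss.
Qed.

Lemma sum_drop_rank_seq i : n <= i -> i <= q ->
  \sum_(k <- drop i rank_seq) rot_val k + 2 ^ (q - i + n) + (q - i) + 1 <=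
  (q - i) * 2 ^ q + 2 ^ (q - i) + 2 ^ n.
Proof.
move=> n_i i_q; set s := drop i rank_seq.
have us : uniq s by apply: drop_uniq uniq_rank_seq.
have ss : size s = q - i by rewrite size_drop // size_rank_seq.
have sq : {in s, forall k, k < q} by move=> k /mem_drop; rewrite mem_rank_seq.
have Tz : marks_zeros (map negb w) (mem s).
  move=> k; rewrite size_map => kq /(nthP 0)[j]; rewrite ss => ji <-.
  rewrite nth_drop (nth_map false) ?nth_rank_seq; try lia.
  by rewrite -mem_rank_seq mem_nth // size_rank_seq; lia.
have := marked_rot_sum_ge Tz; rewrite /nmarks /marked_rot_sum size_map.
rewrite sum_mem_subseq // -/q.
rewrite (eq_bigr (fun k => (k \in s) * 1)) => [|k _]; last by rewrite muln1.
rewrite sum_mem_subseq // sum1_size ss.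
have -> : count id (map negb w) = n.
  by rewrite /n /q /p -(count_predC id w) addKn count_map.
(* A rotation and its complement have values adding up to 2^q - 1, which turns the lower bound for
   the complement into an upper bound. *)
suff : \sum_(k <- s) bin_val (rot k (map negb w)) + \sum_(k <- s) rot_val k
   + (q - i) = (q - i) * 2 ^ q by lia.
rewrite -ss -sum1_size -!big_split big_distrl; apply: eq_bigr => k _ /=.
by rewrite -map_rot bin_val_negb size_rot mul1n.
Qed.

Lemma sum_Ival i : i <= q ->
  \sum_(k < i) Ival w k.+1 = \sum_(k <- take i rank_seq) rot_val k.
Proof.
move=> iq; rewrite [RHS](big_nth 0) size_takel ?size_rank_seq // big_mkord.
by apply: eq_bigr => k _; rewrite IvalE ?nth_take //; have := ltn_ord k; lia.
Qed.

Lemma sum_Ival_low i : i <= n ->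
  2 ^ (i + p) + 1 <= \sum_(k < i) Ival w k.+1 + 2 ^ i + 2 ^ p.
Proof. by move=> i_n; rewrite sum_Ival ?sum_take_rank_seq //; rewrite /n in i_n; lia. Qed.

Lemma sum_Ival_high i : n <= i -> i <= q ->
  p * 2 ^ q + 2 ^ (q - i + n) + (q - i) + 1 <=
  \sum_(k < i) Ival w k.+1 + p + (q - i) * 2 ^ q + 2 ^ (q - i) + 2 ^ n.
Proof.
move=> n_i i_q; rewrite sum_Ival //.
have := sum_drop_rank_seq n_i i_q; have := sum_rot_val.
by rewrite -{1}(cat_take_drop i rank_seq) big_cat /=; lia.
Qed.

Lemma Ival_mono i j : i <= j -> j < q -> Ival w i.+1 <= Ival w j.+1.
Proof.
move=> ij jq; rewrite !IvalE //; last lia.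
apply: (sorted_leq_nth (leT := relpre rot_val leq) _ _ 0 rot_val_sorted) => //.
- by move=> a b c /=; apply: leq_trans.
- by move=> a /=.
- by rewrite inE size_rank_seq; lia.
- by rewrite inE size_rank_seq.
Qed.

Lemma Ival_gt0 k : 0 < p -> k < q -> 0 < Ival w k.+1.
Proof.
move=> p0 kq; rewrite IvalE // /rot_val.
have := bin_val_ones (rot (nth 0 rank_seq k) w).
have -> : count id (rot (nth 0 rank_seq k) w) = p.
  by apply/permP; rewrite perm_rot.
have : 2 ^ 1 <= 2 ^ p by rewrite leq_exp2l.
by rewrite expn1; lia.
Qed.

End Ranking.

(** * From partial sums to products *)

Section Majorization.
Import Order.TTheory GRing.Theory Num.Theory.
Local Open Scope ring_scope.

(* The induction needs the stronger bound
   (sum of (y k - x k)) / y (j - 1) <= j - sum of x k / y k. *)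
Lemma sum_ratio_le (x y : nat -> nat) i :
  (forall k, (k < i)%N -> (0 < y k)%N) ->
  (forall k l, (k <= l < i)%N -> (y k <= y l)%N) ->
  (forall j, (j <= i)%N -> (\sum_(k < j) x k <= \sum_(k < j) y k)%N) ->
  \sum_(k < i) ((x k)%:R / (y k)%:R : rat) <= i%:R.
Proof.
move=> y0 ymono xy.
suff /(_ i) H : forall j, (j <= i)%N -> (0 < j)%N ->
    (\sum_(k < j) (y k)%:R - \sum_(k < j) (x k)%:R) / (y j.-1)%:R <=
    j%:R - \sum_(k < j) ((x k)%:R / (y k)%:R : rat).
  case: i y0 ymono xy H => [|i] y0 ymono xy H; first by rewrite big_ord0.
  rewrite -subr_ge0; apply: le_trans (H _ _) => //.
  by rewrite divr_ge0 ?ler0n // subr_ge0 -!natr_sum ler_nat xy.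
elim=> [//|[|j] IH] ji _.
  rewrite !big_ord_recr !big_ord0 /= !add0r mulrBl divff //.
  by rewrite pnatr_eq0 -lt0n y0.
have {}IH := IH (ltnW ji) isT.
rewrite !(big_ord_recr j.+1) /= -[j.+2]addn1 natrD.
set Y := \sum_(k < j.+1) (y k)%:R in IH *.
set X := \sum_(k < j.+1) (x k)%:R in IH *.
set r := \sum_(k < j.+1) _ in IH *.
have y1 : (y j.+1)%:R != 0 :> rat by rewrite pnatr_eq0 -lt0n y0.
have -> : (Y + (y j.+1)%:R - (X + (x j.+1)%:R)) / (y j.+1)%:R =
    (Y - X) / (y j.+1)%:R + (1 - (x j.+1)%:R / (y j.+1)%:R).
  by rewrite opprD addrACA mulrDl [X in _ + X]mulrBl divff.
(* The new terms cancel; by [IH] it remains to compare (Y - X) / y (j + 1) with (Y - X) / y j, where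
   Y - X is nonnegative and y is nondecreasing. *)
rewrite opprD addrACA lerD2r; apply: le_trans IH.
apply: ler_wpM2l; first by rewrite subr_ge0 /X /Y -!natr_sum ler_nat xy // ltnW.
rewrite lef_pV2 ?posrE ?ltr0n ?y0 //; last exact: ltnW.
by rewrite ler_nat ymono // leqnSn.
Qed.

(** The ratios x k / y k have mean at most 1, hence by AM-GM product at most 1. *)
Lemma prod_le_of_sum_le (x y : nat -> nat) i :
  (forall k, (k < i)%N -> (0 < y k)%N) ->
  (forall k l, (k <= l < i)%N -> (y k <= y l)%N) ->
  (forall j, (j <= i)%N -> (\sum_(k < j) x k <= \sum_(k < j) y k)%N) ->
  (\prod_(k < i) x k <= \prod_(k < i) y k)%N.
Proof.
move=> y0 ymono xy; case: (posnP i) => [->|i0]; first by rewrite !big_ord0.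
pose E (k : 'I_i) : rat := (x k)%:R / (y k)%:R.
have sumE : \sum_k E k <= i%:R := sum_ratio_le y0 ymono xy.
have E0 k : 0 <= E k by rewrite divr_ge0 ?ler0n.
have /leif_AGM[+ _] : {in 'I_i, forall k, 0 <= E k} by move=> k _.
rewrite card_ord => AGM.
have : \prod_k E k <= 1.
  apply: le_trans AGM _; apply: exprn_ile1.
    by rewrite divr_ge0 ?ler0n // sumr_ge0.
  by rewrite ler_pdivrMr ?ltr0n // mul1r.
rewrite prodf_div -!natr_prod ler_pdivrMr ?mul1r ?ler_nat // ltr0n.
by apply: prodn_gt0 => k; apply: y0.
Qed.

End Majorization.

(** * Explicit values and partial sums for u *)

Lemma eq_perm_eq (T : eqType) (s t : seq T) : s = t -> perm_eq s t.
Proof. by move->. Qed.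

Lemma exp2_gt0 m : 0 < 2 ^ m.
Proof. by rewrite expn_gt0. Qed.

(* I_(k+1)(u): the words 0^(n-k) 1^p 0^k for k < n, then 1^s 0^n 1^(p-s) with
   s = k - n + 1, where n = q - p. *)
Definition uval p q k :=
  if k < q - p then 2 ^ (k + p) - 2 ^ k
  else 2 ^ q + 2 ^ (q - k.+1) - (2 ^ (q - p + (q - k.+1)) + 1).

Lemma uval_low p q k : k < q - p -> uval p q k + 2 ^ k = 2 ^ (k + p).
Proof. by move=> kn; rewrite /uval kn subnK // leq_exp2l // leq_addr. Qed.

Lemma uval_high p q k : q - p <= k < q ->
  uval p q k + 2 ^ (q - p + (q - k.+1)) + 1 = 2 ^ q + 2 ^ (q - k.+1).
Proof.
move=> kn; rewrite /uval ltnNge; have /andP[-> kq] := kn; rewrite /= -addnA subnK //.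
by apply: leq_add; rewrite ?exp2_gt0 // leq_exp2l //; lia.
Qed.

Lemma bin_val_nseq0 m : bin_val (nseq m false) = 0.
Proof. by elim: m => [|m IH] //=; rewrite bin_val_cons IH. Qed.

Lemma bin_val_nseq1 m : bin_val (nseq m true) + 1 = 2 ^ m.
Proof. by elim: m => [|m IH] //=; rewrite bin_val_cons size_nseq expnS /=; lia. Qed.

Lemma rot_val_uword_low p q k : p <= q -> k < q - p ->
  rot_val (uword p q) k = uval p q k.
Proof.
move=> pq kn; apply/(@addIn (2 ^ k)); rewrite uval_low //.
rewrite /rot_val /uword /rot drop_cat take_cat size_nseq kn.
rewrite drop_nseq take_nseq; last exact: ltnW.
rewrite !bin_val_cat !bin_val_nseq0 !size_nseq expnD -(bin_val_nseq1 p).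
by lia.
Qed.

(** This rotation is 1^(p-k) 0^(q-p) 1^k. A longer leading run of ones ranks higher, so ranks
    decrease as k grows. *)
Lemma rot_val_uword_high p q k : p <= q -> k < p ->
  rot_val (uword p q) (q - p + k) = uval p q (q.-1 - k).
Proof.
move=> pq kp; apply/(@addIn (2 ^ (q - p + k) + 1)).
have := @uval_high p q (q.-1 - k).
have -> : q - (q.-1 - k).+1 = k by lia.
rewrite !addnA => ->; last lia.
have /negbTE kF : ~~ (q - p + k < q - p) by lia.
rewrite /rot_val /uword /rot drop_cat take_cat size_nseq kF addKn.
rewrite drop_nseq take_nseq; last exact: ltnW.
rewrite !bin_val_cat !bin_val_nseq0 !size_cat !size_nseq.
have -> : 2 ^ q = 2 ^ (p - k) * 2 ^ (q - p + k) by rewrite -expnD; congr (_ ^ _); lia.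
by rewrite -(bin_val_nseq1 (p - k)) -(bin_val_nseq1 k); lia.
Qed.

Lemma uval_mono p q k : 1 <= p -> p < q -> k.+1 < q -> uval p q k <= uval p q k.+1.
Proof.
move=> p1 pq kq; case: (ltnP k.+1 (q - p)) => kn.
  have := uval_low kn; have := uval_low (ltnW kn).
  have : 2 ^ k <= 2 ^ (k + p) by rewrite leq_exp2l // leq_addr.
  by rewrite addSn !expnS; lia.
have := @uval_high p q k.+1; rewrite kn kq => /(_ isT).
case: (ltnP k (q - p)) => kn'.
  (* At this boundary the leading letter turns from 0 to 1, so 2^(q-1) separates the two values. *)
  have kE : q - p = k.+1 by lia.
  have -> : q - p + (q - k.+2) = q.-1 by lia.
  have := uval_low kn'; have -> : k + p = q.-1 by lia.
  have -> : 2 ^ q = 2 * 2 ^ q.-1 by rewrite -expnS; congr (_ ^ _); lia.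
  by have := exp2_gt0 k; have := exp2_gt0 (q - k.+2); lia.
have := @uval_high p q k; rewrite kn' (ltnW kq) => /(_ isT).
have -> : q - k.+1 = (q - k.+2).+1 by lia.
rewrite (addnS (q - p)) !expnS.
have : 2 ^ (q - k.+2) <= 2 ^ (q - p + (q - k.+2)) by rewrite leq_exp2l // leq_addl.
by lia.
Qed.

(** The [uval] list is nondecreasing and rearranges the values of the rotations, hence is their
    sorted list. *)
Lemma Ival_uword p q k : 1 <= p -> p < q -> k < q -> Ival (uword p q) k.+1 = uval p q k.
Proof.
move=> p1 pq kq.
have su : size (uword p q) = q by rewrite size_cat !size_nseq; lia.
rewrite IvalE ?su // -(nth_map 0 0) ?size_rank_seq ?su // /rank_seq -sort_map su.
have -> : sort leq [seq rot_val (uword p q) j | j <- iota 0 q] =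
          [seq uval p q j | j <- iota 0 q].
  apply: (sorted_eq leq_trans anti_leq).
  - exact: sort_sorted leq_total _.
  - rewrite sorted_map; apply/(sortedP 0) => j; rewrite size_iota => jq.
    by rewrite /= !nth_iota ?add0n ?uval_mono //; lia.
  - rewrite perm_sort.
    have -> : iota 0 q = iota 0 (q - p) ++ iota (q - p) p by rewrite -iotaD; congr iota; lia.
    rewrite !map_cat; apply: perm_cat.
      apply/eq_perm_eq/eq_in_map => j; rewrite mem_iota => jn.
      by rewrite rot_val_uword_low; lia.
    rewrite perm_sym -perm_rev perm_sym; apply: eq_perm_eq.
    apply: (@eq_from_nth _ 0); first by rewrite size_rev !size_map !size_iota.
    move=> j; rewrite size_map size_iota => jp.
    rewrite nth_rev size_map size_iota // !(nth_map 0) ?size_iota ?nth_iota; try lia.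
    by rewrite rot_val_uword_high; [congr uval|..]; lia.
by rewrite (nth_map 0) ?size_iota // nth_iota.
Qed.

(** The word u attains equality in [sum_Ival_low]. *)
Lemma sum_uval_low p q i : i <= q - p ->
  \sum_(k < i) uval p q k + 2 ^ i + 2 ^ p = 2 ^ (i + p) + 1.
Proof.
elim: i => [|i IH] i_n; first by rewrite big_ord0 addnC.
rewrite big_ord_recr /= addSn !expnS.
have := IH (ltnW i_n); have := uval_low i_n.
by move: (bigop _ _ _) => S; lia.
Qed.

(** With i = q - p + s, this is the equality case of [sum_Ival_high]. *)
Lemma sum_uval_high p q s : p <= q -> s <= p ->
  \sum_(k < q - p + s) uval p q k + s + 2 ^ (q - p) + 2 ^ (p - s) =
  s * 2 ^ q + 2 ^ (q - s) + 1.
Proof.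
move=> pq; elim: s => [|s IH] sp.
  have := sum_uval_low (leqnn (q - p)); rewrite subnK // !addn0 !subn0; lia.
rewrite (addnS (q - p)) big_ord_recr /=.
have := IH (ltnW sp); have := @uval_high p q (q - p + s).
have -> : q - (q - p + s).+1 = p - s.+1 by lia.
have -> : p - s = (p - s.+1).+1 by lia.
have -> : q - s = (q - s.+1).+1 by lia.
have -> : q - p + (p - s.+1) = q - s.+1 by lia.
have -> : q - p <= q - p + s < q by lia.
by move=> /(_ isT); rewrite !expnS; move: (bigop _ _ _) => S; lia.
Qed.

(** * Comparison of u with w *)

Lemma sum_Ival_uword_le p q (w : seq bool) i : 1 <= p -> p < q ->
  size w = q -> count id w = p -> i <= q ->
  \sum_(k < i) Ival (uword p q) k.+1 <= \sum_(k < i) Ival w k.+1.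
Proof.
move=> p1 pq sw cw iq.
rewrite (eq_bigr (fun k : 'I_i => uval p q k)); last first.
  by move=> k _; apply: Ival_uword => //; have := ltn_ord k; lia.
case: (leqP i (q - p)) => i_n.
  have := @sum_Ival_low w i; rewrite sw cw => /(_ i_n).
  have := sum_uval_low i_n.
  (* Both sums become opaque variables, leaving linear arithmetic between the exact value for u and
     the bound for w. *)
  by move: (bigop _ _ _) (bigop _ _ (fun k => BigBody k _ _ (Ival _ _))) => S1 S2; lia.
have [s iE] : exists s, i = q - p + s by exists (i - (q - p)); lia.
have := @sum_Ival_high w i; rewrite sw cw => /(_ (ltnW i_n) iq).
have -> : q - i = p - s by lia.
have sp : s <= p by lia.
have := sum_uval_high (ltnW pq) sp; rewrite -iE.
have -> : p - s + (q - p) = q - s by lia.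
have -> : p * 2 ^ q = s * 2 ^ q + (p - s) * 2 ^ q by rewrite -mulnDl subnKC.
move: ((p - s) * _) => ps.
by move: (bigop _ _ _) (bigop _ _ (fun k => BigBody k _ _ (Ival _ _))) => S1 S2; lia.
Qed.

Theorem theorem6 (p q : nat) (hp : 1 <= p) (hpq : p < q - p)
  (w : seq bool) (hw : size w = q) (hones : count id w = p) :
  forall i, 1 <= i <= q -> Pprod (uword p q) i <= Pprod w i.
Proof.
move=> i /andP[_ iq]; rewrite /Pprod !big_add1 /= !big_mkord.
apply: (@prod_le_of_sum_le (fun k => Ival (uword p q) k.+1) (fun k => Ival w k.+1)).
- by move=> k ki; apply: Ival_gt0; rewrite ?hones ?hw //; lia.
- by move=> k l /andP[kl li]; apply: Ival_mono; rewrite ?hw //; lia.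
- by move=> j ji; apply: sum_Ival_uword_le => //; lia.
Qed.
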